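(* Let $S$ be an $E$-dense semigroup whose set of idempotents $E$ is a semilattice, let $X$ be an effective, transitive $E$-dense $S$-act, let $x\in X$ and let $H=S_x$. Then $X$ is isomorphic to $S/H$. Moreover, if $K$ is a closed $E$-dense subsemigroup of $S$ and $X$ is isomorphic to $S/K$, then there exists $x\in X$ such that $K=S_x$.
   Context: For a semigroup $S$, $E=E(S)$ is its set of idempotents and $W(s)=\{s'\in S\mid s'ss'=s'\}$ is the set of weak inverses of $s\in S$. $S$ is $E$-dense if for every $s\in S$ there are $t,u\in S$ with $ts\in E$ and $su\in E$ (equivalently $W(s)\neq\emptyset$ for all $s$). $E$ is a semilattice if it is a subsemigroup and its elements commute. Partial order on $S$: $s\le t$ iff $s=t$ or there are $e,f\in E$ with $s=te=ft$. For $A\subseteq S$, $A\omega=\{s\in S\mid a\le s\text{ for some }a\in A\}$, and $A$ is closed if $A=A\omega$. An $E$-dense $S$-act is a nonempty set $X$ with a partial map $S\times X\to X$, $(s,x)\mapsto sx$, such that $(st)x$ exists iff $tx$ and $s(tx)$ exist, and then $(st)x=s(tx)$; which is cancellative (if $sx,sy$ exist and $sx=sy$ then $x=y$) and reflexive (if $sx$ exists then there is $s'\in W(s)$ such that $s'(sx)$ exists). Write $D_s^X=\{x\in X\mid sx\text{ exists}\}$, $D^x=\{s\in S\mid sx\text{ exists}\}$, and $S_x=\{s\in D^x\mid sx=x\}$ (stabilizer). $X$ is effective if $D^x\neq\emptyset$ for all $x\in X$, and transitive if for all $x,y\in X$ there is $s\in D^x$ with $y=sx$. An ($E$-dense) $S$-map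 $f:X\to Y$ between $E$-dense $S$-acts is a function such that for all $s\in S$, $x\in D^X_s$ if and only if $f(x)\in D^Y_s$, and then $f(sx)=sf(x)$; an isomorphism is a bijective $S$-map. An $E$-dense subsemigroup of $S$ is a (nonempty) subsemigroup $H$ with $W(h)\cap H\ne\emptyset$ for all $h\in H$. For a closed $E$-dense subsemigroup $H$, let $D_H=\{s\in S\mid \exists s'\in W(s),\ s's\in H\}$; $S/H$ is the set of left $\omega$-cosets $(sH)\omega$, $s\in D_H$, and it is an $E$-dense $S$-act under $s\cdot X=(sX)\omega$, defined exactly when $X\in S/H$ and $(sX)\omega\in S/H$. For an effective $E$-dense $S$-act with $E$ a semilattice each stabilizer $S_x$ is a closed $E$-dense subsemigroup of $S$, so that $S/S_x$ makes sense. *)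

(* Defs.v *)
From mathcomp Require Import all_boot.
From mathcomp Require Import boolp classical_sets.

Set Implicit Arguments.
Unset Strict Implicit.
Unset Printing Implicit Defensive.

Local Open Scope classical_set_scope.
Local Open Scope group_scope.

Definition idempotents (S : semigroupType) : set S := [set e | e * e = e].

Definition weak_inverses (S : semigroupType) (s : S) : set S :=
  [set s' | s' * s * s' = s'].

Definition E_dense (S : semigroupType) : Prop :=
  forall s : S, (exists t, idempotents (t * s)) /\
                (exists u, idempotents (s * u)).

Definition idempotents_semilattice (S : semigroupType) : Prop :=
  forall e f : S, idempotents e -> idempotents f ->
    idempotents (e * f) /\ e * f = f * e.

Definition sg_le (S : semigroupType) (s t : S) : Prop :=
  s = t \/ exists e f, [/\ idempotents e, idempotents f, s = t * e & s = f * t].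

Definition omega (S : semigroupType) (A : set S) : set S :=
  [set s | exists2 a, A a & sg_le a s].

Definition omega_closed (S : semigroupType) (A : set S) : Prop := A = omega A.

Definition E_dense_subsemigroup (S : semigroupType) (H : set S) : Prop :=
  [/\ H !=set0,
      (forall h k, H h -> H k -> H (h * k))
    & (forall h, H h -> weak_inverses h `&` H !=set0)].

(* [act s x = None] means that [s x] does not exist. *)
Record partial_act (S : semigroupType) := PartialAct {
  act_carrier :> Type;
  act : S -> act_carrier -> option act_carrier
}.

Section Acts.
Variable S : semigroupType.
Implicit Types X Y : partial_act S.

Definition dom_of X (s : S) : set X := [set x | exists y, act s x = Some y].

Definition dom_at X (x : X) : set S := [set s | exists y, act s x = Some y].

Definition stabilizer X (x : X) : set S := [set s | act s x = Some x].

Definition E_dense_act X : Prop :=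
  [/\ inhabited X,
      (forall (s t : S) (x z : X), act (s * t) x = Some z <->
         exists2 y, act t x = Some y & act s y = Some z),
      (forall (s : S) (x y z : X),
         act s x = Some z -> act s y = Some z -> x = y)
    & (forall (s : S) (x y : X), act s x = Some y ->
         exists2 s', weak_inverses s s' & dom_of s' y)].

Definition effective X : Prop := forall x : X, dom_at x !=set0.

Definition act_transitive X : Prop :=
  forall x y : X, exists s, act s x = Some y.

Definition S_map X Y (f : X -> Y) : Prop :=
  forall (s : S) (x : X), (dom_of s x <-> dom_of s (f x)) /\
    (forall y, act s x = Some y -> act s (f x) = Some (f y)).

Definition isomorphic X Y : Prop :=
  exists2 f : X -> Y, S_map f & bijective f.

Definition coset_dom (H : set S) : set S :=
  [set s | exists2 s', weak_inverses s s' & H (s' * s)].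

Definition left_coset (s : S) (A : set S) : set S :=
  omega [set s * a | a in A].

Definition left_cosets (H : set S) : set (set S) :=
  [set left_coset s H | s in coset_dom H].

(* [insub B] is [Some] of [B] when [B] is in [left_cosets H], and [None]
   otherwise; the coset A ranges over the subtype of [set S] it defines. The
   definition makes sense for any [H]; it gives an E-dense act when [H] is a
   closed E-dense subsemigroup and the idempotents form a semilattice. *)
Definition coset_act (H : set S) : partial_act S :=
  @PartialAct S (set_type (left_cosets H))
    (fun s A => insub (left_coset s (val A))).

End Acts.

(* Main.v *)
Require Import Defs.
From mathcomp Require Import all_boot.
From mathcomp Require Import boolp classical_sets.

(** In an E-dense act idempotents act as partial identities, so whenever
    [t x = y], reflexivity supplies a weak inverse [t'] of [t] with [t' y = x]:
    where they are defined, the elements of [S] act like invertible ones.  Write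
    [T y] for the set of all [t] with [t x = y].  If [s] and [t] both lie in
    [T y], choose weak inverses [s'] and [t'] sending [y] back to [x]; then [s' t t' t]
    stabilizes [x], and [s (s' t t' t) = (s s') t t' t] lies below [t]
    ([restriction_le]).  Since [T y] is upward closed, [T y] is the left
    omega-coset [(s H)omega] of the stabilizer [H] of [x]
    ([transporter_coset]).  So [y |-> T y] maps [X] to the cosets of [H]; it is
    injective because a nonempty [T y] determines [y], surjective because
    [s' s x = x] forces [s x] to exist, and compatible with the action because
    [(t T y)omega = T (t y)].

    For the second part, the elements [s] with [(s K)omega = K] are exactly
    those of the closed E-dense subsemigroup [K] ([left_coset_stable]).  In
    particular [K] is itself a coset, and its stabilizer in [S/K] is [K]; an
    isomorphism carries stabilizers to stabilizers, so the preimage of the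
    point [K] is the required point of [X]. *)

Set Implicit Arguments.
Unset Strict Implicit.
Unset Printing Implicit Defensive.

Local Open Scope classical_set_scope.
Local Open Scope group_scope.

(** * Weak inverses and the natural order *)

Section Order.
Variable S : semigroupType.
Implicit Types (s t e : S) (A : set S).

Lemma sg_le_refl s : sg_le s s.
Proof. by left. Qed.

Lemma weak_inverse_idem s s' : weak_inverses s s' ->
  idempotents (s' * s) /\ idempotents (s * s').
Proof.
rewrite /weak_inverses /idempotents /= => ws.
by split; [rewrite mulgA ws | rewrite -mulgA (mulgA s') ws].
Qed.

Lemma idem_weak_inverse e : idempotents e -> weak_inverses e e.
Proof. by rewrite /weak_inverses /idempotents /= => ee; rewrite !ee. Qed.

Lemma sub_omega A : A `<=` omega A.
Proof. by move=> a Aa; exists a => //; apply: sg_le_refl. Qed.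

Lemma omega_mono A B : A `<=` B -> omega A `<=` omega B.
Proof. by move=> AB s [a /AB Ba les]; exists a. Qed.

Hypothesis semiE : idempotents_semilattice S.

Lemma idem_conj e t t' : idempotents e -> weak_inverses t t' ->
  idempotents (t' * e * t).
Proof.
move=> ee wt; have [_ tt'] := weak_inverse_idem wt.
have [_ comm] := semiE ee tt'.
rewrite /idempotents /=.
rewrite [LHS](_ : _ = t' * (e * (t * t') * e) * t); last by rewrite !mulgA.
rewrite comm -(mulgA (t * t')) ee !mulgA.
by rewrite /weak_inverses /= in wt; rewrite wt.
Qed.

Lemma idem_conj' e t t' : idempotents e -> weak_inverses t t' ->
  idempotents (t * e * t').
Proof.
move=> ee wt; have [t't _] := weak_inverse_idem wt.
have [_ comm] := semiE ee t't.
rewrite /idempotents /=.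
rewrite [LHS](_ : _ = t * (e * ((t' * t) * e)) * t'); last by rewrite !mulgA.
rewrite -comm !mulgA -(mulgA t e e) ee -!mulgA.
by rewrite /weak_inverses /= -mulgA in wt; rewrite wt.
Qed.

(** For a non-regular [t] the product [e t] need not lie below [t]; replacing
    [t] by its regular part [t t' t] makes the idempotent [e] pass through [t],
    as [e (t t') t = (t t') e t = t (t' e t)]. *)
Lemma restriction_le e t t' : idempotents e -> weak_inverses t t' ->
  sg_le (e * (t * t' * t)) t.
Proof.
move=> ee wt; have [_ tt'] := weak_inverse_idem wt.
have [idem comm] := semiE ee tt'.
right; exists (t' * e * t), (e * (t * t')).
split=> //; [exact: idem_conj | | by rewrite mulgA].
by rewrite mulgA comm !mulgA.
Qed.

Lemma corestriction_le e t t' : idempotents e -> weak_inverses t t' ->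
  sg_le (t * t' * t * e) t.
Proof.
move=> ee wt; have [t't _] := weak_inverse_idem wt.
have [_ comm] := semiE ee t't; have [idem _] := semiE t't ee.
right; exists (t' * t * e), (t * e * t').
split=> //; [exact: idem_conj' | by rewrite !mulgA |].
by rewrite -!mulgA; congr (_ * _); rewrite mulgA -comm.
Qed.

(** * Closed E-dense subsemigroups *)

Variable K : set S.
Hypotheses (closedK : omega_closed K) (denseK : E_dense_subsemigroup K).

Lemma E_dense_subsemigroup_idem : exists2 e, idempotents e & K e.
Proof.
case: denseK => -[h Kh] KM KW; have [h' [wh Kh']] := KW _ Kh.
by exists (h' * h); [have [] := weak_inverse_idem wh | apply: KM].
Qed.

(** For [s] and [k] in [K], with weak inverses [s'] and [k'] in [K], the element
    [s (s' k k' k)] of [s K] is below [k]: this gives [K] inside [(s K)omega].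
    Conversely, from [(s K)omega = K] one gets [k = s e] in [K] for an idempotent [e] of
    [K]; if [k'] is a weak inverse of [k] in [K], then [e k'] is one of [s],
    which puts an element below [s] into [K]. *)
Lemma left_coset_stable s : left_coset s K = K <-> K s.
Proof.
have [_ KM KW] := denseK.
split=> [sKK | Ks].
  have [e ee Ke] := E_dense_subsemigroup_idem.
  have Kse : K (s * e) by rewrite -sKK; apply: sub_omega; exists e.
  have [k' [wk Kk']] := KW _ Kse.
  have ws : weak_inverses s (e * k').
    by have := congr1 (fun u => e * u) wk; rewrite /weak_inverses /= !mulgA.
  rewrite closedK; exists (s * (e * k') * s * e).
    by rewrite mulgA -(mulgA _ s); apply: (KM) => //; apply: KM.
  exact: corestriction_le.
rewrite eqEsubset; split=> [|k Kk].
  rewrite {2}closedK; apply: omega_mono => _ [k Kk <-]; exact: KM.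
have [s' [ws Ks']] := KW _ Ks; have [k' [wk Kk']] := KW _ Kk.
exists (s * s' * (k * k' * k)).
  by exists (s' * (k * k' * k)); rewrite ?mulgA //; do ?apply: (KM).
by apply: restriction_le => //; have [] := weak_inverse_idem ws.
Qed.

(** [K] is the coset of any of its idempotents. *)
Lemma left_cosets_self : left_cosets K K.
Proof.
have [e ee Ke] := E_dense_subsemigroup_idem.
exists e; last exact/left_coset_stable.
exists e; first exact: idem_weak_inverse.
by rewrite /idempotents /= in ee; rewrite ee.
Qed.

End Order.

(** * Coset acts *)

Section CosetAct.
Variables (S : semigroupType) (H : set S).

Definition coset_point B (cosB : left_cosets H B) : coset_act H :=
  (Sub B (mem_set cosB) : set_type (left_cosets H)).

Lemma val_coset_point B (cosB : left_cosets H B) : val (coset_point cosB) = B.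
Proof. by []. Qed.

Lemma coset_actE (s : S) (A B : coset_act H) :
  act s A = Some B <-> left_coset s (val A) = val B.
Proof.
rewrite /act /=; split=> [|eqB].
  by case: insubP => // C _ <- [->].
by rewrite eqB valK.
Qed.

Lemma coset_act_dom (s : S) (A : coset_act H) :
  dom_of s A <-> left_cosets H (left_coset s (val A)).
Proof.
split=> [[B /coset_actE ->]|cosA]; first exact/set_mem/valP.
by exists (coset_point cosA); apply/coset_actE; rewrite val_coset_point.
Qed.

End CosetAct.

(** * Transporters in an E-dense act *)

Section Transporter.
Variables (S : semigroupType) (X : partial_act S).
Hypotheses (semiE : idempotents_semilattice S) (actX : E_dense_act X).
Implicit Types (s t e : S) (x y z : X).

Definition transporter x y : set S := [set s | act s x = Some y].

Lemma actM s t x y z : act t x = Some y -> act s y = Some z ->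
  act (s * t) x = Some z.
Proof. by case: actX => _ aM _ _ tx sy; apply/aM; exists y. Qed.

Lemma actM_inv s t x z : act (s * t) x = Some z ->
  exists2 y, act t x = Some y & act s y = Some z.
Proof. by case: actX => _ aM _ _ /aM. Qed.

(** If [e x = y] then [e y = (e e) x = y = e x], and cancellation applies. *)
Lemma act_idem e x y : idempotents e -> act e x = Some y -> y = x.
Proof.
case: actX => _ _ aI _ ee ex.
have : act (e * e) x = Some y by rewrite ee.
by case/actM_inv => y'; rewrite ex => -[<-] ey; apply: aI ey ex.
Qed.

(** The point [s' y] that reflexivity provides is [(s' s) x], the image of [x]
    under an idempotent. *)
Lemma act_weak_inverse s x y : act s x = Some y ->
  exists2 s', weak_inverses s s' & act s' y = Some x.
Proof.
case: actX => _ _ _ aR sx; have [s' ws [z s'y]] := aR _ _ _ sx.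
exists s' => //; have [s's _] := weak_inverse_idem ws.
by rewrite s'y (act_idem s's (actM sx s'y)).
Qed.

(** If [s = t e] with [e] idempotent, then [s x = t (e x) = t x]; this is what
    makes transporters upward closed. *)
Lemma act_le s t x y : sg_le s t -> act s x = Some y -> act t x = Some y.
Proof.
case=> [-> //|[e [f [ee _ -> _]]]] /actM_inv[z ez tz].
by rewrite -(act_idem ee ez).
Qed.

Lemma omega_transporter x y A : A `<=` transporter x y ->
  omega A `<=` transporter x y.
Proof. by move=> AT t [a /AT Ta lea]; apply: act_le lea Ta. Qed.

(** The nontrivial inclusion: [t] in the transporter dominates [s] times the
    stabilizing element [s' t t' t]. *)
Lemma transporter_coset x y s : act s x = Some y ->
  left_coset s (stabilizer x) = transporter x y.
Proof.
move=> sx; rewrite eqEsubset; split=> [|t tx].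
  by apply: omega_transporter => _ [h hx <-]; apply: actM hx sx.
have [s' ws s'y] := act_weak_inverse sx.
have [t' wt t'y] := act_weak_inverse tx.
exists (s * s' * (t * t' * t)).
  exists (s' * (t * t' * t)); last by rewrite !mulgA.
  exact: actM (actM tx (actM t'y tx)) s'y.
by apply: restriction_le wt => //; have [] := weak_inverse_idem ws.
Qed.

Lemma act_coset_dom s x y : act s x = Some y -> coset_dom (stabilizer x) s.
Proof.
by move=> sx; have [s' ws s'y] := act_weak_inverse sx; exists s' => //;
  apply: actM sx s'y.
Qed.

(** With [H] the stabilizer of [x], the transporter to [z] is the coset of
    [t s], and [t s H] is contained in [t] times the transporter to [y]. *)
Lemma left_coset_transporter x y z s t : act s x = Some y ->
  act t y = Some z -> left_coset t (transporter x y) = transporter x z.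
Proof.
move=> sx ty; rewrite eqEsubset; split=> [|u].
  by apply: omega_transporter => _ [a ax <-]; apply: actM ax ty.
rewrite -(transporter_coset (actM sx ty)).
apply: omega_mono => _ [h hx <-].
by exists (s * h); rewrite ?mulgA //; apply: actM hx sx.
Qed.

Lemma transporter_inj x y z s : act s x = Some y ->
  transporter x y = transporter x z -> y = z.
Proof.
move=> sx eqT; have : transporter x z s by rewrite -eqT.
by rewrite /transporter /= sx => -[].
Qed.

Hypothesis transX : act_transitive X.

Lemma transporter_left_cosets x y :
  left_cosets (stabilizer x) (transporter x y).
Proof.
have [s sx] := transX x y.
by exists s; [apply: act_coset_dom sx | apply: transporter_coset].
Qed.

Definition to_coset x y : coset_act (stabilizer x) :=
  coset_point (transporter_left_cosets x y).

Lemma left_cosetsP x A : left_cosets (stabilizer x) A ->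
  exists y, A = transporter x y.
Proof.
move=> [s [s' ws /actM_inv[y sx _]] <-].
by exists y; apply: transporter_coset.
Qed.

(** That [t y] exists once [t] sends the transporter of [y] to some coset: that
    coset is the transporter to some [z], and it contains [t s] for any [s] with
    [s x = y], so [t (s x) = z]. *)
Lemma to_coset_map x : S_map (to_coset x).
Proof.
move=> t y; have [s sx] := transX x y.
have step z : act t y = Some z -> act t (to_coset x y) = Some (to_coset x z).
  move=> ty; apply/coset_actE; rewrite !val_coset_point.
  exact: left_coset_transporter sx ty.
split=> //; split=> [[z /step tz]|/coset_act_dom].
  by exists (to_coset x z).
rewrite val_coset_point => /left_cosetsP[z eqz].
have : transporter x z (t * s).
  by rewrite -eqz; apply: sub_omega; exists s.
by move=> /actM_inv[y']; rewrite sx => -[<-] ty; exists z.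
Qed.

Lemma to_coset_bij x : bijective (to_coset x).
Proof.
have surj A : exists y, to_coset x y = A.
  have [y eqA] := left_cosetsP (set_mem (valP A)).
  by exists y; apply: val_inj; rewrite val_coset_point.
have [g gK] := choice surj; exists g => // y.
have [s sx] := transX x (g (to_coset x y)).
apply: (transporter_inj sx).
by have := congr1 val (gK (to_coset x y)); rewrite !val_coset_point.
Qed.

End Transporter.

(** * Stabilizers *)

Lemma stabilizer_iso (S : semigroupType) (X Y : partial_act S) (f : X -> Y)
    (x : X) : S_map f -> injective f -> stabilizer x = stabilizer (f x).
Proof.
move=> fM fI; rewrite eqEsubset; split=> s sx; first exact: (fM s x).2.
have [z sz] : dom_of s x by apply/(fM s x).1; exists (f x).
have := (fM s x).2 _ sz; rewrite /stabilizer /= in sx *.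
by rewrite sx => -[/fI xz]; rewrite sz -xz.
Qed.

Lemma stabilizer_coset (S : semigroupType) (K : set S) (A : coset_act K) :
  idempotents_semilattice S -> omega_closed K -> E_dense_subsemigroup K ->
  val A = K -> stabilizer A = K.
Proof.
move=> semiE clK dK AK; rewrite eqEsubset; split=> s.
  by move/coset_actE; rewrite AK => /(left_coset_stable semiE clK dK).
by move/(left_coset_stable semiE clK dK) => sK; apply/coset_actE; rewrite AK.
Qed.

Theorem theorem2p22 (S : semigroupType) (X : partial_act S) (x : X)
    (H : set S) :
  E_dense S -> idempotents_semilattice S ->
  E_dense_act X -> effective X -> act_transitive X ->
  H = stabilizer x ->
  isomorphic X (coset_act H) /\
  (forall K : set S, omega_closed K -> E_dense_subsemigroup K ->
     isomorphic X (coset_act K) -> exists y : X, K = stabilizer y).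
Proof.
move=> _ semiE actX _ transX ->; split=> [|K clK dK [f fM fB]].
  exists (to_coset semiE actX transX x); first exact: to_coset_map.
  exact: to_coset_bij.
have [g _ gK] := fB.
pose A := coset_point (left_cosets_self semiE clK dK).
exists (g A); rewrite (stabilizer_iso _ fM (bij_inj fB)) gK.
by rewrite (stabilizer_coset semiE clK dK) ?val_coset_point.
Qed.
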